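(* Let $0<m<n$ be integers. Then (a) the set $\mathcal{T}_{(m)}^\vee$ of comb representatives in $U_{(m)}$ is a set of superclass representatives for $U_{(m)}$, i.e. every superclass of $U_{(m)}$ contains exactly one element of $\mathcal{T}_{(m)}^\vee$; and (b) the set $\mathcal{Z}_{(m)}^\vee$ of path representatives in $U_{(m)}$ is a set of superclass representatives for $U_{(m)}$, i.e. every superclass of $U_{(m)}$ contains exactly one element of $\mathcal{Z}_{(m)}^\vee$.
   Context: Let $\mathbb{F}_q$ be a finite field with $q$ elements and $U_n$ the group of $n\times n$ unipotent upper-triangular matrices over $\mathbb{F}_q$. For $0\le m\le n$ let $U_{(m)}=\{u\in U_n : u_{1j}=0 \text{ for } 1<j\le m\}$ and $\mathfrak{n}_{(m)}=\{u-1 : u\in U_{(m)}\}$, a nilpotent $\mathbb{F}_q$-algebra on which $U_{(m)}$ acts by left and right multiplication. Two elements $u,v\in U_{(m)}$ are in the same superclass if $u-1$ and $v-1$ lie in the same two-sided orbit, i.e. $v-1=x(u-1)y$ for some $x,y\in U_{(m)}$. For a matrix $A$, let $G_A$ be the graph whose vertices are the nonzero entries of $A$ (labelled by their positions), with an edge joining two distinct nonzero entries whenever they lie in the same row or in the same column. Comb representative: $u\in U_{(m)}$ is a comb representative if (i) at most one connected component of $G_{u-1}$ has more than one vertex, and (ii) if $G_{u-1}$ has a connected component $S$ with more than one vertex, then there are $r\ge 1$, $r'\in\{r-1,r\}$ and integers $1<i_{r'}<i_{r'-1}<\cdots<i_1\le m<k_1<k_2<\cdots<k_r\le n$ such that the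 set of positions of the vertices of $S$ is exactly $$\{(1,k_d): 1\le d\le r\}\cup\{(i_d,k_d): 1\le d\le r'\}.$$ Path representative: $u\in U_{(m)}$ is a path representative if (i) at most one connected component of $G_{u-1}$ has more than one vertex, and (ii) if $G_{u-1}$ has a connected component $S$ with more than one vertex, then there are $r\ge 1$, $r'\in\{r-1,r\}$ and integers $1<i_{r'}<i_{r'-1}<\cdots<i_1\le m<k_1<k_2<\cdots<k_r\le n$ such that the set of positions of the vertices of $S$ is exactly $$\{(1,k_1)\}\cup\{(i_d,k_d): 1\le d\le r'\}\cup\{(i_d,k_{d+1}): 1\le d\le r-1\}.$$ $\mathcal{T}_{(m)}^\vee$ is the set of all comb representatives and $\mathcal{Z}_{(m)}^\vee$ the set of all path representatives in $U_{(m)}$. *)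

(* Defs.v *)
From mathcomp Require Import all_boot all_order all_algebra.

Set Implicit Arguments.
Unset Strict Implicit.
Unset Printing Implicit Defensive.

Import GRing.Theory.
Local Open Scope ring_scope.

(* Rows and columns are numbered from 1 in the mathematics; the index a : 'I_n
   stands for the number a.+1. *)

Section PatternGroup.

Variables (F : finFieldType) (n : nat).

Definition unitriangular : {set 'M[F]_n} :=
  [set u : 'M[F]_n | [forall a : 'I_n, u a a == 1] &&
    [forall a : 'I_n, forall b : 'I_n, (b < a)%N ==> (u a b == 0)]].

Definition Um (m : nat) : {set 'M[F]_n} :=
  [set u in unitriangular | [forall a : 'I_n, forall b : 'I_n,
    [&& a.+1 == 1, 1 < b.+1 & b.+1 <= m]%N ==> (u a b == 0)]].

Definition superclass (m : nat) (u : 'M[F]_n) : {set 'M[F]_n} :=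
  [set v in Um m | [exists x in Um m, exists y in Um m,
    v - 1%:M == x *m (u - 1%:M) *m y]].

Definition superclasses (m : nat) : {set {set 'M[F]_n}} :=
  [set superclass m u | u in Um m].

Definition superclass_representatives (m : nat) (T : 'M[F]_n -> Prop) : Prop :=
  (forall u, T u -> u \in Um m) /\
  (forall K, K \in superclasses m -> exists! u, u \in K /\ T u).

Definition nonzero_positions (A : 'M[F]_n) : {set 'I_n * 'I_n} :=
  [set p | A p.1 p.2 != 0].

Definition entry_graph (A : 'M[F]_n) : rel ('I_n * 'I_n) :=
  [rel p q | [&& p \in nonzero_positions A, q \in nonzero_positions A, p != q
               & (p.1 == q.1) || (p.2 == q.2)]].

(* [connect] is reflexive on all positions, so the components are taken only
   at vertices, i.e. at nonzero entries. *)
Definition components (A : 'M[F]_n) : {set {set 'I_n * 'I_n}} :=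
  [set [set q | connect (entry_graph A) p q] | p in nonzero_positions A].

Definition nontrivial_components (A : 'M[F]_n) : {set {set 'I_n * 'I_n}} :=
  [set S in components A | (1 < #|S|)%N].

End PatternGroup.

(* 1 < i_{r'} < ... < i_1 <= m < k_1 < ... < k_r <= n; only the values i d for
   1 <= d <= r' and k d for 1 <= d <= r are relevant. *)
Definition admissible (n m r r' : nat) (i k : nat -> nat) : Prop :=
  [/\ (1 <= r)%N,
      r' = r.-1 \/ r' = r,
      (forall d, (1 <= d <= r')%N -> (1 < i d <= m)%N)
        /\ (forall d, (1 <= d < r')%N -> (i d.+1 < i d)%N)
    & (forall d, (1 <= d <= r)%N -> (m < k d <= n)%N)
        /\ (forall d, (1 <= d < r)%N -> (k d < k d.+1)%N)].

Definition comb_position (r r' : nat) (i k : nat -> nat) (p : nat * nat) : Prop :=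
  (exists2 d, (1 <= d <= r)%N & p = (1%N, k d)) \/
  (exists2 d, (1 <= d <= r')%N & p = (i d, k d)).

Definition path_position (r r' : nat) (i k : nat -> nat) (p : nat * nat) : Prop :=
  [\/ p = (1%N, k 1%N),
      (exists2 d, (1 <= d <= r')%N & p = (i d, k d))
    | (exists2 d, (1 <= d <= r.-1)%N & p = (i d, k d.+1))].

Definition is_comb (n m : nat) (S : {set 'I_n * 'I_n}) : Prop :=
  exists r r' : nat, exists i k : nat -> nat, admissible n m r r' i k /\
    (forall a b : 'I_n, (a, b) \in S <-> comb_position r r' i k (a.+1, b.+1)).

Definition is_path (n m : nat) (S : {set 'I_n * 'I_n}) : Prop :=
  exists r r' : nat, exists i k : nat -> nat, admissible n m r r' i k /\
    (forall a b : 'I_n, (a, b) \in S <-> path_position r r' i k (a.+1, b.+1)).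

Definition comb_representative (F : finFieldType) (n m : nat) (u : 'M[F]_n) : Prop :=
  [/\ u \in Um F n m,
      (#|nontrivial_components (u - 1%:M)| <= 1)%N
    & forall S, S \in nontrivial_components (u - 1%:M) -> is_comb m S].

Definition path_representative (F : finFieldType) (n m : nat) (u : 'M[F]_n) : Prop :=
  [/\ u \in Um F n m,
      (#|nontrivial_components (u - 1%:M)| <= 1)%N
    & forall S, S \in nontrivial_components (u - 1%:M) -> is_path m S].

(* Main.v *)
Require Import Defs.
From mathcomp Require Import all_boot all_order all_algebra.
From mathcomp Require Import zify ring.

(* Put A = u - 1. Left and right multiplication by U_(m) add lower rows to
   higher ones and left columns to right ones, except that row 1 only receives
   rows below m. Sweeping the positions from the bottom row up, and from left
   to right in each row, brings A to a comb: the rows below the first form a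
   rook placement, and if two entries of row 1 in columns j < k survive then the
   rook of column j is strictly lower than that of column k.
   Conversely, if X A = B Y with A and B combs, comparing entries in the same
   order gives A = B: at a position where A or B is nonzero all the correction
   terms vanish, the decisive one being Y_jk = 0 for j < k in the first row,
   which is read off the row of the rook of column j.
   Subtracting from each column k_(d+1) of a comb the multiple of column k_d
   which kills its entry in row 1 gives a path; this is a map from combs onto
   paths which preserves orbits, so paths are representatives as well. *)

Set Implicit Arguments.
Unset Strict Implicit.
Unset Printing Implicit Defensive.

Import GRing.Theory.
Local Open Scope ring_scope.

Section Superclasses.

Variables (F : finFieldType) (n m : nat).
Hypothesis m_gt0 : (0 < m)%N.

Implicit Types (A B u v x y : 'M[F]_n.+1) (a b c i j k : 'I_n.+1).

(* The positions at which [u - 1] may be nonzero for [u] in [Um]; transitivity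
   of this relation makes [in_nm] an algebra. *)
Definition allowed a b := ((a < b) && ((a == 0 :> nat) ==> (m <= b)))%N.

Lemma allowed_trans b a c : allowed a b -> allowed b c -> allowed a c.
Proof. rewrite /allowed; lia. Qed.

Definition in_nm A := forall a b, ~~ allowed a b -> A a b = 0.

Lemma in_nm_neq0 A a b : in_nm A -> A a b != 0 -> allowed a b.
Proof. by move=> An; apply: contraR => /An ->. Qed.

Lemma in_UmP u : reflect (in_nm (u - 1%:M)) (u \in Um F n.+1 m).
Proof.
rewrite !inE; apply: (iffP andP) => [[/andP[/forallP ud /forallP ul] /forallP u0] a b ab | nu].
  rewrite !mxE; case: eqVneq => [<-|neq_ab].
    by rewrite (eqP (ud a)) subrr.
  rewrite subr0; have [lt_ba|le_ab] := ltnP b a.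
    by have /forallP/(_ b) := ul a; rewrite lt_ba => /eqP.
  have := u0 a => /forallP/(_ b)/implyP H; apply/eqP/H.
  have: (a : nat) != b by apply: contraNneq neq_ab => /val_inj ->.
  by move: ab; rewrite /allowed; lia.
have nuE a b : ~~ allowed a b -> u a b = (a == b)%:R.
  by move=> /nu; rewrite !mxE => /eqP; rewrite subr_eq0 => /eqP.
split; first (apply/andP; split).
- by apply/forallP=> a; rewrite nuE ?eqxx // /allowed ltnn.
- apply/forallP=> a; apply/forallP=> b; apply/implyP=> lt_ba.
  rewrite nuE; last by rewrite /allowed; lia.
  by case: (eqVneq a b) lt_ba => [->|//]; rewrite ltnn.
- apply/forallP=> a; apply/forallP=> b; apply/implyP=> H.
  rewrite nuE; last by rewrite /allowed; lia.
  by case: (eqVneq a b) H => [->|//]; lia.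
Qed.

Lemma in_nmD A B : in_nm A -> in_nm B -> in_nm (A + B).
Proof. by move=> nA nB a b ab; rewrite mxE nA // nB // addr0. Qed.

Lemma in_nmM A B : in_nm A -> in_nm B -> in_nm (A *m B).
Proof.
move=> nA nB a b ab; rewrite mxE big1 // => c _.
have [ac|/nA->] := boolP (allowed a c); last by rewrite mul0r.
by rewrite nB ?mulr0 //; apply: contra ab; apply: allowed_trans.
Qed.

Lemma Um_mull x A : x \in Um F n.+1 m -> in_nm A -> in_nm (x *m A).
Proof.
move=> /in_UmP nx nA; rewrite -[x](subrK 1%:M) mulmxDl mul1mx.
by apply: in_nmD => //; apply: in_nmM.
Qed.

Lemma Um_mulr A y : y \in Um F n.+1 m -> in_nm A -> in_nm (A *m y).
Proof.
move=> /in_UmP ny nA; rewrite -[y](subrK 1%:M) mulmxDr mulmx1.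
by apply: in_nmD => //; apply: in_nmM.
Qed.

Lemma Um1 : 1%:M \in Um F n.+1 m.
Proof. by apply/in_UmP=> a b _; rewrite subrr mxE. Qed.

Lemma UmM x y : x \in Um F n.+1 m -> y \in Um F n.+1 m -> x *m y \in Um F n.+1 m.
Proof.
move=> /in_UmP nx yU; apply/in_UmP.
rewrite -{1}[x](subrK 1%:M) mulmxDl mul1mx -addrA.
by apply: in_nmD; [apply: Um_mulr | apply/in_UmP].
Qed.

Lemma UmE x a b : x \in Um F n.+1 m -> ~~ allowed a b -> x a b = (a == b)%:R.
Proof. by move=> /in_UmP nx /nx; rewrite !mxE => /eqP; rewrite subr_eq0 => /eqP. Qed.

Lemma Um_unit x : x \in Um F n.+1 m -> x \in unitmx.
Proof.
move=> xU; rewrite unitmxE -det_tr det_trig.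
  by rewrite big1 ?unitr1 // => a _; rewrite mxE UmE ?eqxx // /allowed ltnn.
apply/is_trig_mxP => a b lt_ab; rewrite mxE UmE // /allowed; last by lia.
by case: (eqVneq b a) lt_ab => [->|//]; rewrite ltnn.
Qed.

(* Left multiplication by an invertible element permutes the finite set [Um]. *)
Lemma Um_inv x : x \in Um F n.+1 m -> invmx x \in Um F n.+1 m.
Proof.
move=> xU; have x_unit := Um_unit xU.
have inj_x : {in Um F n.+1 m &, injective (mulmx x)}.
  by move=> y z _ _ /(congr1 (mulmx (invmx x))); rewrite !mulKmx.
have sub_x : mulmx x @: Um F n.+1 m \subset Um F n.+1 m.
  by apply/subsetP=> _ /imsetP[y yU ->]; apply: UmM.
have /eqP im_x : mulmx x @: Um F n.+1 m == Um F n.+1 m.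
  by rewrite eqEcard sub_x (card_in_imset inj_x) leqnn.
have /imsetP[y yU e] : 1%:M \in mulmx x @: Um F n.+1 m by rewrite im_x Um1.
by rewrite -[invmx x]mulmx1 e mulKmx.
Qed.

Definition sim A B :=
  exists2 x, x \in Um F n.+1 m & exists2 y, y \in Um F n.+1 m & B = x *m A *m y.

Lemma sim_refl A : sim A A.
Proof. by exists 1%:M; rewrite ?Um1 //; exists 1%:M; rewrite ?Um1 // mulmx1 mul1mx. Qed.

Lemma sim_trans B A C : sim A B -> sim B C -> sim A C.
Proof.
move=> [x xU [y yU ->]] [x' x'U [y' y'U ->]].
by exists (x' *m x); rewrite ?UmM //; exists (y *m y'); rewrite ?UmM // !mulmxA.
Qed.

Lemma sim_sym A B : sim A B -> sim B A.
Proof.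
move=> [x xU [y yU ->]].
exists (invmx x); rewrite ?Um_inv //; exists (invmx y); rewrite ?Um_inv //.
by rewrite mulmxA mulmxK ?Um_unit // mulKmx ?Um_unit.
Qed.

Lemma sim_in_nm A B : sim A B -> in_nm A -> in_nm B.
Proof. by move=> [x xU [y yU ->]] nA; apply/Um_mulr/Um_mull. Qed.

Lemma superclassP u v :
  reflect (v \in Um F n.+1 m /\ sim (u - 1%:M) (v - 1%:M)) (v \in superclass m u).
Proof.
rewrite [v \in superclass _ _]in_set; apply: (iffP andP) => [[vU] | [vU [x xU [y yU e]]]].
  case/existsP=> x /andP[xU /existsP[y /andP[yU /eqP e]]].
  by split=> //; exists x => //; exists y.
split=> //; apply/existsP; exists x; rewrite xU; apply/existsP; exists y.
by rewrite yU; apply/eqP.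
Qed.

Lemma superclass_representativesI (T : 'M[F]_n.+1 -> Prop) (Q : 'M[F]_n.+1 -> Prop) :
    (forall u, T u <-> u \in Um F n.+1 m /\ Q (u - 1%:M)) ->
    (forall A, in_nm A -> exists2 B, sim A B & Q B) ->
    (forall A B, in_nm A -> in_nm B -> sim A B -> Q A -> Q B -> A = B) ->
  superclass_representatives m T.
Proof.
move=> TP ex un; split=> [u /TP[]//|_ /imsetP[u uU ->]].
have [B uB QB] := ex _ (elimT (in_UmP u) uU).
have eB : B + 1%:M - 1%:M = B by rewrite addrK.
have nB : in_nm B by apply: sim_in_nm uB _; apply/in_UmP.
have BU : B + 1%:M \in Um F n.+1 m by apply/in_UmP; rewrite eB.
exists (B + 1%:M); split=> [|v [/superclassP[vU uv] /TP[_ Qv]]].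
  by split; [apply/superclassP; rewrite eB | apply/TP; rewrite eB].
rewrite (un _ _ nB _ _ QB Qv) ?subrK //; first exact/in_UmP.
exact: sim_trans (sim_sym uB) uv.
Qed.

Definition row_op i j (s : F) A : 'M[F]_n.+1 :=
  \matrix_(a, b) (A a b + (a == i)%:R * s * A j b).

Definition col_op i j (s : F) A : 'M[F]_n.+1 :=
  \matrix_(a, b) (A a b + (b == j)%:R * s * A a i).

Lemma Um_elementary i j (s : F) :
  allowed i j -> 1%:M + s *: delta_mx i j \in Um F n.+1 m.
Proof.
move=> ij; apply/in_UmP=> a b ab; rewrite [1%:M + _]addrC addrK !mxE.
by case: eqVneq ab => [->|] ab; case: eqVneq ab => [->|]; rewrite ?mulr0 ?ij.
Qed.

Lemma sim_row_op i j s A : allowed i j -> sim A (row_op i j s A).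
Proof.
move=> ij; exists (1%:M + s *: delta_mx i j); first exact: Um_elementary.
exists 1%:M; rewrite ?Um1 // mulmx1 mulmxDl mul1mx.
apply/matrixP=> a b; rewrite !mxE; congr (_ + _).
rewrite (bigD1 j) //= big1 => [|c nc]; rewrite !mxE ?eqxx ?andbT ?addr0 -?mulrA; first by ring.
by rewrite (negPf nc) andbF mul0r mulr0.
Qed.

Lemma sim_col_op i j s A : allowed i j -> sim A (col_op i j s A).
Proof.
move=> ij; exists 1%:M; rewrite ?Um1 //.
exists (1%:M + s *: delta_mx i j); first exact: Um_elementary.
rewrite mul1mx mulmxDr mulmx1.
apply/matrixP=> a b; rewrite !mxE; congr (_ + _).
rewrite (bigD1 i) //= big1 => [|c nc]; rewrite !mxE ?eqxx ?addr0 /=; first by ring.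
by rewrite (negPf nc) mulr0 mulr0.
Qed.

Definition comb_shape A :=
  [/\ forall a a' b, (0 < a)%N -> (0 < a')%N -> A a b != 0 -> A a' b != 0 -> a = a',
      forall a b b', (0 < a)%N -> A a b != 0 -> A a b' != 0 -> b = b',
      forall a b, (0 < a)%N -> A ord0 b != 0 -> A a b != 0 -> (a < m)%N
    & forall b b', (b < b')%N -> A ord0 b != 0 -> A ord0 b' != 0 ->
        exists2 a : 'I_n.+1, (0 < a)%N && (A a b != 0) &
          forall a' : 'I_n.+1, (0 < a')%N -> A a' b' != 0 -> (a' < a)%N].

(* Positions are processed row by row from the bottom, left to right in a row. *)
Definition processed (s t : nat) a b := ((s < a) || ((a == s :> nat) && (b < t)))%N.

Definition mask (s t : nat) A : 'M[F]_n.+1 :=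
  \matrix_(a, b) if processed s t a b then A a b else 0.

Lemma mask_neq0 s t A a b :
  (mask s t A a b != 0) = processed s t a b && (A a b != 0).
Proof. by rewrite mxE; case: ifP => //; rewrite eqxx. Qed.

Lemma processedS (s t a b : 'I_n.+1) :
  processed s t.+1 a b = processed s t a b || ((a == s) && (b == t)).
Proof. rewrite /processed -!val_eqE /=; lia. Qed.

Lemma mask_clear (s t : 'I_n.+1) A A' :
    (forall a b, processed s t a b -> A' a b = A a b) -> A' s t = 0 ->
  mask s t.+1 A' = mask s t A.
Proof.
move=> eA A0; apply/matrixP=> a b; rewrite !mxE processedS.
have [/eA-> //|_ /=] := boolP (processed s t a b).
by case: eqVneq => [->|//]; case: eqVneq => [->|].
Qed.

Lemma clear_below_step (s t : 'I_n.+1) A : (0 < s)%N -> in_nm A ->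
    comb_shape (mask s t A) ->
  exists2 B, sim A B & comb_shape (mask s t.+1 B).
Proof.
move=> s_gt0 nA cA; have [R1 R2 _ _] := cA.
have [Ast0|Ast] := eqVneq (A s t) 0.
  by exists A; [exact: sim_refl | rewrite (@mask_clear s t A)].
have [/existsP[t0 /andP[lt_t0 At0]]|/existsPn no_t0] :=
    boolP [exists t0 : 'I_n.+1, (t0 < t)%N && (A s t0 != 0)].
  exists (col_op t0 t (- (A s t / A s t0)) A).
    apply: sim_col_op; have:= in_nm_neq0 nA At0; rewrite /allowed; lia.
  rewrite (@mask_clear s t A) //; last by rewrite mxE eqxx mul1r; field.
  move=> a b pab; rewrite mxE; case: eqP => [eb|_]; last by rewrite !mul0r addr0.
  suff -> : A a t0 = 0 by rewrite mulr0 addr0.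
  have lt_sa : (s < a)%N by move: pab; rewrite eb /processed; lia.
  apply: contraTeq (lt_sa) => Aa; rewrite (R1 a s t0) ?ltnn ?mask_neq0 ?Aa ?At0 ?andbT //.
  - lia.
  - rewrite /processed; lia.
  - rewrite /processed; lia.
have [/existsP[a /andP[lt_sa Aat]]|/existsPn no_a] :=
    boolP [exists a : 'I_n.+1, (s < a)%N && (A a t != 0)].
  exists (row_op s a (- (A s t / A a t)) A).
    by apply: sim_row_op; rewrite /allowed; lia.
  rewrite (@mask_clear s t A) //; last by rewrite mxE eqxx mul1r; field.
  move=> x b pxb; rewrite mxE; case: eqP => [ex|_]; last by rewrite !mul0r addr0.
  suff -> : A a b = 0 by rewrite mulr0 addr0.
  have lt_bt : (b < t)%N by move: pxb; rewrite ex /processed; lia.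
  apply: contraTeq (lt_bt) => Aa; rewrite (R2 a b t) ?ltnn ?mask_neq0 ?Aa ?Aat ?andbT //.
  - lia.
  - rewrite /processed; lia.
  - rewrite /processed; lia.
have nz c b : mask s t.+1 A c b != 0 ->
    mask s t A c b != 0 \/ [/\ c = s, b = t & A c b != 0].
  rewrite !mask_neq0 processedS => /andP[/orP[->|/andP[/eqP-> /eqP->]] Acb].
    by left; rewrite Acb.
  by right.
exists A; first exact: sim_refl.
split=> [a a' b a_gt0 a'_gt0 | a b b' a_gt0 | a b _ | b b' _].
- move=> /nz[Ma|[-> -> _]] /nz[Ma'|[ea' eb _]].
  + exact: R1 Ma Ma'.
  + move: Ma; rewrite eb ea' mask_neq0 => /andP[pab Aa].
    by have := no_a a; rewrite Aa; move: pab; rewrite /processed; lia.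
  + move: Ma'; rewrite mask_neq0 => /andP[pab Aa].
    by have := no_a a'; rewrite Aa; move: pab; rewrite /processed; lia.
  + by rewrite ea'.
- move=> /nz[Ma|[-> -> _]] /nz[Ma'|[ea' eb _]].
  + exact: R2 Ma Ma'.
  + move: Ma; rewrite eb ea' mask_neq0 => /andP[pab Aa].
    by have := no_t0 b; rewrite Aa; move: pab; rewrite /processed; lia.
  + move: Ma'; rewrite mask_neq0 => /andP[pab Aa].
    by have := no_t0 b'; rewrite Aa; move: pab; rewrite /processed; lia.
  + by rewrite eb.
- by rewrite mask_neq0 /processed /=; lia.
- by rewrite mask_neq0 /processed /=; lia.
Qed.

Lemma clear_top_step (t : 'I_n.+1) A : in_nm A -> comb_shape (mask 0 t A) ->
  exists2 B, sim A B & comb_shape (mask 0 t.+1 B).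
Proof.
move=> nA cA; have [R1 R2 C2 C3] := cA.
have nz0 t' a b : (0 < a)%N -> (mask 0 t' A a b != 0) = (A a b != 0).
  by move=> a_gt0; rewrite mask_neq0 /processed a_gt0.
have nz b : (mask 0 t A ord0 b != 0) = (b < t)%N && (A ord0 b != 0).
  by rewrite mask_neq0 /processed.
have {}R1 a a' b : (0 < a)%N -> (0 < a')%N -> A a b != 0 -> A a' b != 0 -> a = a'.
  by move=> a_gt0 a'_gt0 Aa Aa'; apply: (R1 a a' b); rewrite ?nz0.
have {}R2 a b b' : (0 < a)%N -> A a b != 0 -> A a b' != 0 -> b = b'.
  by move=> a_gt0 Aa Aa'; apply: (R2 a b b'); rewrite ?nz0.
have clear B : (forall a b, processed 0 t a b -> B a b = A a b) ->
    B ord0 t = 0 -> comb_shape (mask 0 t.+1 B).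
  by move=> eB B0; rewrite (@mask_clear ord0 t A).
have [At0|At] := eqVneq (A ord0 t) 0.
  by exists A; [exact: sim_refl | exact: clear].
have [/existsP[a /andP[le_ma Aat]]|/existsPn no_a] :=
    boolP [exists a : 'I_n.+1, (m <= a)%N && (A a t != 0)].
  exists (row_op ord0 a (- (A ord0 t / A a t)) A).
    by apply: sim_row_op; rewrite /allowed /=; lia.
  apply: clear; last by rewrite mxE eqxx mul1r; field.
  move=> x b pxb; rewrite mxE; case: eqP => [ex|_]; last by rewrite !mul0r addr0.
  suff -> : A a b = 0 by rewrite mulr0 addr0.
  have lt_bt : (b < t)%N by move: pxb; rewrite ex /processed.
  by apply: contraTeq (lt_bt) => Aa; rewrite (R2 a b t) ?ltnn //; lia.
have [/existsP[j /and3P[lt_jt Aj /forallP noj]]|/existsPn no_j] :=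
    boolP [exists j : 'I_n.+1, [&& (j < t)%N, A ord0 j != 0 &
             [forall a : 'I_n.+1, (0 < a)%N ==> (A a j == 0)]]].
  exists (col_op j t (- (A ord0 t / A ord0 j)) A).
    apply: sim_col_op; have:= in_nm_neq0 nA Aj; rewrite /allowed /=; lia.
  apply: clear; last by rewrite mxE eqxx mul1r; field.
  move=> x b pxb; rewrite mxE; case: eqP => [eb|_]; last by rewrite !mul0r addr0.
  have /implyP/(_ _)/eqP -> := noj x; last by move: pxb; rewrite eb /processed; lia.
  by rewrite mulr0 addr0.
have [/existsP[j /existsP[a /existsP[a' /and5P[lt_jt Aj Aa Aa' lt_a]]]]|no_ja] :=
    boolP [exists j : 'I_n.+1, exists a : 'I_n.+1, exists a' : 'I_n.+1,
      [&& (j < t)%N, A ord0 j != 0, A a j != 0, A a' t != 0 & (0 < a < a')%N]].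
  pose A1 := col_op j t (- (A ord0 t / A ord0 j)) A.
  have Aj0 c : (0 < c)%N -> c != a -> A c j = 0.
    by move=> c_gt0; apply: contraNeq => Ac; apply/eqP/(R1 _ _ j) => //; lia.
  have A1E c b : (0 < c)%N -> c != a -> A1 c b = A c b.
    by move=> c_gt0 ca; rewrite mxE (Aj0 c) // mulr0 addr0.
  have A1t c b : b != t -> A1 c b = A c b.
    by move=> /negPf nb; rewrite mxE nb !mul0r addr0.
  have a'a : a' != a by apply: contraTneq (lt_a) => ->; lia.
  have a'_gt0 : (0 < a')%N by lia.
  have a_gt0 : (0 < a)%N by lia.
  exists (row_op a a' (- (A1 a t / A a' t)) A1).
    apply: (@sim_trans A1).
      apply: sim_col_op; have:= in_nm_neq0 nA Aj; rewrite /allowed /=; lia.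
    by apply: sim_row_op; rewrite /allowed; lia.
  have a0 : (ord0 == a) = false by rewrite -val_eqE /=; lia.
  apply: clear => [c b pcb|]; last first.
    by rewrite mxE a0 !mul0r addr0 mxE eqxx mul1r; field.
  rewrite mxE [A1 a' b]A1E //; have [ebt|nb] := eqVneq b t; last first.
    rewrite A1t //; case: eqP => [_|]; last by rewrite !mul0r addr0.
    suff -> : A a' b = 0 by rewrite mulr0 addr0.
    by apply: contraNeq nb => Aa'b; apply/eqP/(R2 a').
  have c_gt0 : (0 < c)%N by move: pcb; rewrite ebt /processed; lia.
  rewrite ebt; case: eqVneq => [->|ca]; last by rewrite !mul0r addr0 A1E.
  have -> : A a t = 0 by apply: contraNeq a'a => Aat; apply/eqP/(R1 _ _ t).
  by rewrite mul1r; field.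
have nzS b : (mask 0 t.+1 A ord0 b != 0) -> A ord0 b != 0 /\ ((b < t)%N \/ b = t).
  rewrite mask_neq0 /processed /= => /andP[lt_b ->]; split=> //.
  by move: lt_b; rewrite ltnS leq_eqVlt => /orP[/eqP/val_inj|]; [right | left].
exists A; first exact: sim_refl.
split=> [a a' b a_gt0 a'_gt0 | a b b' a_gt0 | a b a_gt0 | b b' lt_bb'].
- by rewrite !nz0 //; apply: R1.
- by rewrite !nz0 //; apply: R2.
- move=> /nzS[Ab [lt_bt|->]]; rewrite nz0 // => Aab.
    by apply: (C2 a b) => //; rewrite ?nz ?lt_bt ?nz0.
  by have := no_a a; rewrite Aab andbT; lia.
- move=> /nzS[Ab [lt_bt|eb]] /nzS[Ab' [lt_b't|eb']]; try by move: lt_bb'; rewrite ?eb ?eb'; lia.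
    have [a /andP[a_gt0 Aa] a_max] : exists2 a : 'I_n.+1, (0 < a)%N && (mask 0 t A a b != 0) &
          forall a' : 'I_n.+1, (0 < a')%N -> mask 0 t A a' b' != 0 -> (a' < a)%N.
      by apply: C3; rewrite ?nz ?lt_bt ?lt_b't.
    exists a; first by rewrite a_gt0 nz0 // -(nz0 t).
    by move=> a' a'_gt0; rewrite nz0 // => Aa'; apply: a_max; rewrite ?nz0.
  have := no_j b; rewrite lt_bt Ab /= => /forallPn[a]; rewrite negb_imply => /andP[a_gt0 Aa].
  exists a; first by rewrite a_gt0 nz0.
  move=> a' a'_gt0; rewrite nz0 // eb' => Aa'; rewrite ltnNge; apply/negP => le_aa'.
  case/negP: no_ja; apply/existsP; exists b; apply/existsP; exists a; apply/existsP; exists a'.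
  rewrite lt_bt Ab Aa Aa' a_gt0 /= ltn_neqAle le_aa' andbT.
  apply: contraTneq (lt_bt) => /val_inj eaa'.
  by rewrite (R2 a b t) ?ltnn // eaa'.
Qed.

Lemma comb_shape_exists A : in_nm A -> exists2 B, sim A B & comb_shape B.
Proof.
move=> nA.
have row (s : 'I_n.+1) : (exists2 B, sim A B & comb_shape (mask s 0 B)) ->
    forall t, (t <= n.+1)%N -> exists2 B, sim A B & comb_shape (mask s t B).
  move=> Bs; elim=> [//|t IHt lt_tn].
  have [B AB cB] := IHt (ltnW lt_tn).
  have nB := sim_in_nm AB nA.
  have [s0|s_gt0] := posnP s.
    rewrite s0 in cB *; have [C BC cC] := @clear_top_step (Ordinal lt_tn) B nB cB.
    by exists C; first exact: sim_trans BC.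
  have [C BC cC] := @clear_below_step s (Ordinal lt_tn) B s_gt0 nB cB.
  by exists C; first exact: sim_trans BC.
have mask_full s t B : (n.+1 <= t)%N -> mask s t B = \matrix_(a, b) if (s <= a)%N then B a b else 0.
  move=> le_nt; apply/matrixP=> a b; rewrite !mxE /processed (leq_trans (ltn_ord b)) //.
  by rewrite andbT [in RHS]leq_eqVlt eq_sym orbC.
have mask_nil s B : mask s 0 B = \matrix_(a, b) if (s < a)%N then B a b else 0.
  by apply/matrixP=> a b; rewrite !mxE /processed andbF orbF.
have down (k : nat) : (k <= n.+1)%N ->
    exists2 B, sim A B & comb_shape (\matrix_(a, b) if (n.+1 - k <= a)%N then B a b else 0).
  elim: k => [_|k IHk lt_kn].
    exists A; first exact: sim_refl.
    suff -> : \matrix_(a, b) (if (n.+1 - 0 <= a)%N then A a b else 0) = 0 :> 'M_n.+1.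
      by split=> [a a' b _ _|a b b' _|a b _|b b' _]; rewrite mxE eqxx.
    by apply/matrixP=> a b; rewrite !mxE subn0 leqNgt ltn_ord.
  have lt_nk : (n.+1 - k.+1 < n.+1)%N by lia.
  have [|B AB cB] := row (Ordinal lt_nk) _ n.+1 (leqnn _).
    have [B AB cB] := IHk (ltnW lt_kn); exists B => //.
    by rewrite mask_nil /=; have -> : ((n.+1 - k.+1).+1 = n.+1 - k)%N by lia.
  by exists B => //; rewrite mask_full in cB.
have [B AB cB] := down n.+1 (leqnn _); exists B => //.
by move: cB; rewrite subnn; congr comb_shape; apply/matrixP=> a b; rewrite mxE.
Qed.

Lemma comb_shape_unique A B : in_nm A -> in_nm B -> sim A B ->
  comb_shape A -> comb_shape B -> A = B.
Proof.
move=> nA nB [X XU [y yU eB]] cA cB.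
have [A1 A2 A3 A4] := cA; have [B1 B2 B3 B4] := cB.
pose Y := invmx y; have YU : Y \in Um F n.+1 m by apply: Um_inv.
have XA : X *m A = B *m Y by rewrite eB mulmxK ?Um_unit.
have X0 i c : ~~ allowed i c -> i != c -> X i c = 0.
  by move=> ic /negPf ic'; rewrite UmE // ic'.
have Y0 i c : ~~ allowed i c -> i != c -> Y i c = 0.
  by move=> ic /negPf ic'; rewrite UmE // ic'.
have X1 i : X i i = 1 by rewrite UmE ?eqxx // /allowed ltnn.
have Y1 i : Y i i = 1 by rewrite UmE ?eqxx // /allowed ltnn.
have XAE i k : (forall c, allowed i c -> X i c * A c k = 0) -> (X *m A) i k = A i k.
  move=> XA0; rewrite mxE (bigD1 i) //= X1 mul1r big1 ?addr0 // => c ci.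
  by have [/XA0//|ic] := boolP (allowed i c); rewrite X0 ?mul0r // eq_sym.
have BYE i k : (forall c, allowed c k -> B i c * Y c k = 0) -> (B *m Y) i k = B i k.
  move=> BY0; rewrite mxE (bigD1 k) //= Y1 mulr1 big1 ?addr0 // => c ck.
  by have [/BY0//|ic] := boolP (allowed c k); rewrite Y0 ?mulr0.
have below N i k : (0 < i)%N -> (n - i + k < N)%N -> A i k = B i k.
  elim: N i k => // N IHN i k i_gt0 lt_N.
  have eqL c : (c < k)%N -> A i c = B i c by move=> lt_ck; apply: IHN => //; lia.
  have eqD c : (i < c)%N -> A c k = B c k.
    by move=> lt_ic; apply: IHN; have := ltn_ord c; lia.
  have [/andP[/eqP-> /eqP->]//|nz] := boolP ((A i k == 0) && (B i k == 0)).
  have D0 c : (i < c)%N -> A c k = 0.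
    move=> lt_ic; have ic : i != c by apply: contraTneq (lt_ic) => ->; rewrite ltnn.
    apply: contraNeq nz => Ack; apply/andP; split; apply: contraNT ic => nz.
      by apply/eqP/(A1 _ _ k) => //; lia.
    by apply/eqP/(B1 _ _ k); rewrite -?(eqD c) //; lia.
  have L0 c : (c < k)%N -> B i c = 0.
    move=> lt_ck; have ck : c != k by apply: contraTneq (lt_ck) => ->; rewrite ltnn.
    apply: contraNeq nz => Bic; apply/andP; split; apply: contraNT ck => nz.
      by apply/eqP/(A2 i); rewrite ?(eqL c).
    by apply/eqP/(B2 i).
  rewrite -XAE; last by move=> c ic; rewrite D0 ?mulr0 //; move: ic; rewrite /allowed; lia.
  rewrite XA BYE // => c ck; rewrite L0 ?mul0r //; move: ck; rewrite /allowed; lia.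
have {}below i k : (0 < i)%N -> A i k = B i k by move=> i_gt0; apply: below i_gt0 (ltnSn _).
have top N k : (k < N)%N -> A ord0 k = B ord0 k.
  elim: N k => // N IHN k lt_N.
  have eqL c : (c < k)%N -> A ord0 c = B ord0 c by move=> lt_ck; apply: IHN; lia.
  have [/andP[/eqP-> /eqP->]//|nz] := boolP ((A ord0 k == 0) && (B ord0 k == 0)).
  have D0 c : (m <= c)%N -> A c k = 0.
    move=> le_mc; have c_gt0 : (0 < c)%N by lia.
    apply: contraNeq nz => Ack; apply/andP; split; apply: contraTT le_mc => nz; rewrite -ltnNge.
      exact: A3 nz Ack.
    by apply: B3 nz _; rewrite -?below.
  rewrite -XAE; last first.
    by move=> c ic; rewrite D0 ?mulr0 //; move: ic; rewrite /allowed /=; lia.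
  rewrite XA BYE // => c ck.
  have [->|Bc] := eqVneq (B ord0 c) 0; first by rewrite mul0r.
  have lt_ck : (c < k)%N by move: ck; rewrite /allowed; lia.
  have [i /andP[i_gt0 Bic] i_max] : exists2 i : 'I_n.+1, (0 < i)%N && (B i c != 0) &
      forall i' : 'I_n.+1, (0 < i')%N -> B i' k != 0 -> (i' < i)%N.
    move: nz; rewrite negb_and => /orP[nz|nz]; last exact: B4.
    have [i /andP[i_gt0 Aic] i_max] := A4 _ _ lt_ck (etrans (congr1 (fun z => z != 0) (eqL _ lt_ck)) Bc) nz.
    exists i => [|i' i'_gt0]; first by rewrite i_gt0 -below.
    by rewrite -below //; apply: i_max.
  suff -> : Y c k = 0 by rewrite mulr0.
  have: (X *m A) i k = 0.
    rewrite mxE big1 // => i' _; have [->|Xi] := eqVneq (X i i') 0; first by rewrite mul0r.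
    have le_ii' : (i <= i')%N.
      rewrite leqNgt; apply: contraNN Xi => lt_i'i; apply/eqP/X0.
        by rewrite /allowed; lia.
      by apply: contraTneq lt_i'i => ->; rewrite ltnn.
    have i'_gt0 : (0 < i')%N by lia.
    have [->|Aik] := eqVneq (A i' k) 0; first by rewrite mulr0.
    by have := i_max i' i'_gt0; rewrite -below // => /(_ Aik); lia.
  rewrite XA mxE (bigD1 c) //= big1 => [|c' c'c]; last first.
    have [->|Bic'] := eqVneq (B i c') 0; first by rewrite mul0r.
    by case/eqP: c'c; apply: (B2 i).
  by rewrite addr0 => /eqP; rewrite mulf_eq0 (negPf Bic) => /eqP.
apply/matrixP=> i k; have [i0|i_gt0] := posnP i; last exact: below.
by have -> : i = ord0 by [apply: val_inj]; apply: top (ltnSn _).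
Qed.

Definition rook A :=
  (forall a a' b, (0 < a)%N -> (0 < a')%N -> A a b != 0 -> A a' b != 0 -> a = a') /\
  (forall a b b', (0 < a)%N -> A a b != 0 -> A a b' != 0 -> b = b').

Section Admissible.

Variables (r r' : nat) (I K : nat -> 'I_n.+1).
Hypothesis adm : admissible n.+1 m r r' (fun d => (I d).+1) (fun d => (K d).+1).

Lemma admissible_rank : (0 < r)%N && (r.-1 <= r' <= r)%N.
Proof. by case: adm => ? [->|->] _ _; lia. Qed.

Lemma admissible_rowP d : (0 < d <= r')%N -> (0 < I d < m)%N.
Proof. by case: adm => _ _ [H _] _ /H. Qed.

Lemma admissible_colP d : (0 < d <= r)%N -> (m <= K d)%N.
Proof. by case: adm => _ _ _ [H _] /H; lia. Qed.

Lemma admissible_row_lt d e : (0 < d)%N -> (d < e <= r')%N -> (I e < I d)%N.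
Proof.
case: adm => _ _ [_ H] _ d_gt0; elim: e => // e IHe.
rewrite ltnS leq_eqVlt => /andP[/orP[/eqP ed|lt_de] le_er].
  by have := H d; rewrite -ed; lia.
by have := H e; have := IHe; lia.
Qed.

Lemma admissible_col_lt d e : (0 < d)%N -> (d < e <= r)%N -> (K d < K e)%N.
Proof.
case: adm => _ _ _ [_ H] d_gt0; elim: e => // e IHe.
rewrite ltnS leq_eqVlt => /andP[/orP[/eqP ed|lt_de] le_er].
  by have := H d; rewrite -ed; lia.
by have := H e; have := IHe; lia.
Qed.

Lemma admissible_row_inj d e :
  (0 < d <= r')%N -> (0 < e <= r')%N -> I d = I e -> d = e.
Proof.
move=> dr er /(congr1 val) /= eI.
have := @admissible_row_lt d e; have := @admissible_row_lt e d; lia.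
Qed.

Lemma admissible_col_inj d e :
  (0 < d <= r)%N -> (0 < e <= r)%N -> K d = K e -> d = e.
Proof.
move=> dr er /(congr1 val) /= eK.
have := @admissible_col_lt d e; have := @admissible_col_lt e d; lia.
Qed.

Definition in_comb a b :=
  (exists2 d, (0 < d <= r)%N & a = ord0 /\ b = K d) \/
  (exists2 d, (0 < d <= r')%N & a = I d /\ b = K d).

Definition in_path a b :=
  [\/ a = ord0 /\ b = K 1,
      exists2 d, (0 < d <= r')%N & a = I d /\ b = K d
    | exists2 d, (0 < d < r)%N & a = I d /\ b = K d.+1].

Lemma in_combE a b :
  in_comb a b <-> comb_position r r' (fun d => (I d).+1) (fun d => (K d).+1) (a.+1, b.+1).
Proof.
split=> [[[d dr [-> ->]]|[d dr [-> ->]]]|[[d dr [ea eb]]|[d dr [ea eb]]]].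
- by left; exists d.
- by right; exists d.
- by left; exists d => //; split; apply: val_inj.
- by right; exists d => //; split; apply: val_inj.
Qed.

Lemma in_pathE a b :
  in_path a b <-> path_position r r' (fun d => (I d).+1) (fun d => (K d).+1) (a.+1, b.+1).
Proof.
split=> [[[-> ->]|[d dr [-> ->]]|[d dr [-> ->]]]|[[ea eb]|[d dr [ea eb]]|[d dr [ea eb]]]].
- by constructor 1.
- by constructor 2; exists d.
- by constructor 3; exists d => //; lia.
- by constructor 1; split; apply: val_inj.
- by constructor 2; exists d => //; split; apply: val_inj.
- by constructor 3; exists d; [lia | split; apply: val_inj].
Qed.

End Admissible.

Lemma admissible_ord r r' (i k : nat -> nat) : admissible n.+1 m r r' i k ->
  exists I K : nat -> 'I_n.+1,
  [/\ admissible n.+1 m r r' (fun d => (I d).+1) (fun d => (K d).+1),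
      forall d, (0 < d <= r')%N -> i d = (I d).+1
    & forall d, (0 < d <= r)%N -> k d = (K d).+1].
Proof.
move=> [r_gt0 rr' [i1 i2] [k1 k2]].
have lt_mn : (m < n.+1)%N.
  have /andP[? ?] : (m < k 1%N <= n.+1)%N by apply: k1; rewrite r_gt0.
  by lia.
have iE d : (0 < d <= r')%N -> i d = (@inord n (i d).-1).+1.
  by move=> dr; have /andP[? ?] := i1 d dr; rewrite inordK; lia.
have kE d : (0 < d <= r)%N -> k d = (@inord n (k d).-1).+1.
  by move=> dr; have /andP[? ?] := k1 d dr; rewrite inordK; lia.
exists (fun d => inord (i d).-1), (fun d => inord (k d).-1); split=> //.
split=> //; split=> d dr.
- by rewrite -iE //; apply: i1.
- by rewrite -!iE; [apply: i2 | lia | lia].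
- by rewrite -kE //; apply: k1.
- by rewrite -!kE; [apply: k2 | lia | lia].
Qed.

Lemma is_combP (S : {set 'I_n.+1 * 'I_n.+1}) : is_comb m S <->
  exists r r' (I K : nat -> 'I_n.+1),
    admissible n.+1 m r r' (fun d => (I d).+1) (fun d => (K d).+1) /\
    forall a b, (a, b) \in S <-> in_comb r r' I K a b.
Proof.
split=> [[r [r' [i [k [adm SE]]]]]|[r [r' [I [K [adm SE]]]]]]; last first.
  exists r, r', (fun d => (I d).+1), (fun d => (K d).+1); split=> // a b.
  by rewrite SE in_combE.
have [I [K [admIK iE kE]]] := admissible_ord adm.
have rr' := admissible_rank admIK.
exists r, r', I, K; split=> // a b; rewrite SE in_combE.
split=> -[] [d dr]; [left|right|left|right]; exists d => //.
- by rewrite -kE.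
- by rewrite -iE // -kE //; lia.
- by rewrite kE.
- by rewrite iE // kE //; lia.
Qed.

Lemma is_pathP (S : {set 'I_n.+1 * 'I_n.+1}) : is_path m S <->
  exists r r' (I K : nat -> 'I_n.+1),
    admissible n.+1 m r r' (fun d => (I d).+1) (fun d => (K d).+1) /\
    forall a b, (a, b) \in S <-> in_path r r' I K a b.
Proof.
split=> [[r [r' [i [k [adm SE]]]]]|[r [r' [I [K [adm SE]]]]]]; last first.
  exists r, r', (fun d => (I d).+1), (fun d => (K d).+1); split=> // a b.
  by rewrite SE in_pathE.
have [I [K [admIK iE kE]]] := admissible_ord adm.
have rr' := admissible_rank admIK.
exists r, r', I, K; split=> // a b; rewrite SE in_pathE.
split=> -[|[d dr]|[d dr]]; [constructor 1|constructor 2|constructor 3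
                           |constructor 1|constructor 2|constructor 3]; try exists d => //.
- by rewrite -kE; last lia.
- by rewrite -iE // -kE //; lia.
- by rewrite -iE -?kE //; lia.
- by rewrite kE; last lia.
- by rewrite iE // kE //; lia.
- by rewrite iE ?kE //; lia.
Qed.

Lemma entry_graphE A a b a' b' : entry_graph A (a, b) (a', b') =
  [&& A a b != 0, A a' b' != 0, (a, b) != (a', b') & (a == a') || (b == b')].
Proof. by rewrite /entry_graph /= !inE. Qed.

Lemma entry_graph_sym A : symmetric (entry_graph A).
Proof.
move=> [a b] [a' b']; rewrite !entry_graphE.
by rewrite [_ == (a, b)]eq_sym [a' == a]eq_sym [b' == b]eq_sym andbCA.
Qed.

Lemma connect_edge (T : finType) (e : rel T) (p q : T) :
  connect e p q -> p != q -> exists z, e p z.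
Proof.
case/connectP=> -[|z s] /=; first by move=> _ ->; rewrite eqxx.
by case/andP=> px _ _ _; exists z.
Qed.

Lemma nontrivial_component_edge A p q : entry_graph A p q ->
  exists S, [/\ S \in nontrivial_components A, p \in S, q \in S,
    forall z, z \in S -> A z.1 z.2 != 0
    & forall z w, z \in S -> entry_graph A z w -> w \in S].
Proof.
move=> pq; exists [set z | connect (entry_graph A) p z].
have pS : p \in [set z | connect (entry_graph A) p z] by rewrite inE.
have qS : q \in [set z | connect (entry_graph A) p z] by rewrite inE connect1.
have [pA _ npq _] := and4P pq.
split=> // [|z|z w]; last 1 first.
- by rewrite !inE => px xy; apply: connect_trans px (connect1 xy).
- rewrite inE; apply/andP; split; first by apply/imsetP; exists p.
  rewrite (cardsD1 p) pS (cardsD1 q) !inE eq_sym npq /= connect1 //.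
- rewrite inE => px; have [<-|nx] := eqVneq p z; first by rewrite inE in pA.
  rewrite (sym_connect_sym (@entry_graph_sym A)) in px.
  have [|w] := connect_edge px; first by rewrite eq_sym.
  by case: z {px nx} => z1 z2; case: w => w1 w2; rewrite entry_graphE => /and4P[].
Qed.

Lemma nontrivial_componentsP A (C : 'I_n.+1 * 'I_n.+1 -> Prop) p0 :
    (forall p, C p -> connect (entry_graph A) p0 p) ->
    (forall p q, entry_graph A p q -> C p) ->
  forall S, S \in nontrivial_components A -> forall p, p \in S <-> C p.
Proof.
move=> C_con C_edge S; rewrite inE => /andP[/imsetP[p _ ->] S_gt1].
have con_sym := sym_connect_sym (@entry_graph_sym A).
have Cp : C p.
  have : (0 < #|[set q | connect (entry_graph A) p q] :\ p|)%N.
    have pS : p \in [set q | connect (entry_graph A) p q] by rewrite inE.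
    by rewrite -ltnS; move: S_gt1; rewrite [X in (1 < X)%N](cardsD1 p) pS.
  case/card_gt0P=> q; rewrite !inE => /andP[qp pq].
  by have [|z /C_edge//] := connect_edge pq; rewrite eq_sym.
move=> q; rewrite inE; split=> [pq|Cq].
  have [<-//|npq] := eqVneq p q; rewrite con_sym in pq.
  by have [|z /C_edge//] := connect_edge pq; rewrite eq_sym.
by apply: connect_trans (C_con q Cq); rewrite con_sym; apply: C_con.
Qed.

Lemma card_nontrivial_components A (C : 'I_n.+1 * 'I_n.+1 -> Prop) :
    (forall S, S \in nontrivial_components A -> forall p, p \in S <-> C p) ->
  (#|nontrivial_components A| <= 1)%N.
Proof.
move=> SC; apply/card_le1_eqP=> S S' /SC SE /SC S'E; apply/setP=> p.
by apply/idP/idP; rewrite SE S'E.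
Qed.

Definition comb_data r r' (I K : nat -> 'I_n.+1) A :=
  [/\ admissible n.+1 m r r' (fun d => (I d).+1) (fun d => (K d).+1),
      forall b, A ord0 b != 0 <-> exists2 d, (0 < d <= r)%N & b = K d
    & forall a d, (0 < a)%N -> (0 < d <= r)%N ->
        (A a (K d) != 0) = (d <= r')%N && (a == I d)].

Lemma comb_data_shape r r' I K A : comb_data r r' I K A -> rook A -> comb_shape A.
Proof.
move=> [adm row0 col] [R1 R2]; have rr' := admissible_rank adm; split=> //.
- move=> a b a_gt0 /row0[d dr ->]; rewrite col // => /andP[dr' /eqP->].
  by have := @admissible_rowP _ _ _ _ adm d; lia.
- move=> b b' lt_bb' /row0[d dr bE] /row0[e er b'E].
  have lt_de : (d < e)%N.
    rewrite ltnNge leq_eqVlt; apply/negP => /orP[/eqP ed|lt_ed].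
      by move: lt_bb'; rewrite bE b'E ed ltnn.
    by have := @admissible_col_lt _ _ _ _ adm e d; rewrite -bE -b'E; lia.
  have Id := @admissible_rowP _ _ _ _ adm d.
  exists (I d); first by rewrite bE col ?eqxx ?andbT; lia.
  move=> a' a'_gt0; rewrite b'E col // => /andP[er' /eqP->].
  by apply: (admissible_row_lt adm); lia.
Qed.

Lemma comb_shape_data A b0 : in_nm A -> comb_shape A -> A ord0 b0 != 0 ->
  exists r r' I K, comb_data r r' I K A.
Proof.
move=> nA [R1 R2 C2 C3] Ab0.
pose ks := [seq b <- enum 'I_n.+1 | A ord0 b != 0].
have mem_ks b : (b \in ks) = (A ord0 b != 0) by rewrite mem_filter mem_enum andbT.
have ks_sorted : sorted (fun b c => (b < c)%N) ks.
  apply: sorted_filter; first by move=> ? ? ?; apply: ltn_trans.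
  by have := iota_ltn_sorted 0 n.+1; rewrite -val_enum_ord sorted_map.
pose r := size ks; pose K d := nth ord0 ks d.-1.
pose I d := odflt ord0 [pick a : 'I_n.+1 | (0 < a)%N && (A a (K d) != 0)].
have KP d : (0 < d <= r)%N -> A ord0 (K d) != 0.
  by move=> dr; rewrite -mem_ks mem_nth //; move: dr; rewrite -/r; lia.
have K_lt d : (0 < d < r)%N -> (K d < K d.+1)%N.
  move=> dr; apply: (sorted_ltn_nth _ ord0 ks_sorted); rewrite ?inE -/r; try lia.
  by move=> ? ? ?; apply: ltn_trans.
have IP a d : (0 < a)%N -> A a (K d) != 0 -> I d = a.
  rewrite /I; case: pickP => [a' /andP[a'_gt0 Aa'] a_gt0 Aa|/(_ a)]; first exact: R1 Aa.
  by move=> e a_gt0 Aa; rewrite a_gt0 Aa in e.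
have I_ex d a : (0 < a)%N -> A a (K d) != 0 -> (0 < I d)%N && (A (I d) (K d) != 0).
  by move=> a_gt0 Aa; rewrite (IP a) // a_gt0.
have I_lt d : (0 < d < r)%N -> (0 < I d)%N && (A (I d) (K d) != 0) /\
    forall a', (0 < a')%N -> A a' (K d.+1) != 0 -> (a' < I d)%N.
  move=> dr; have [||a /andP[a_gt0 Aa] a_max] := C3 _ _ (K_lt d dr).
  - by apply: KP; lia.
  - by apply: KP; lia.
  by rewrite (IP a) // a_gt0.
have r_gt0 : (0 < r)%N by rewrite lt0n size_eq0; apply: contraTneq Ab0 => ks0; rewrite -mem_ks ks0.
pose r' := if (0 < I r)%N && (A (I r) (K r) != 0) then r else r.-1.
have I_ok d : (0 < d <= r')%N -> (0 < I d)%N && (A (I d) (K d) != 0).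
  rewrite /r'; case: ifP => [Ir dr|_ dr]; last by have [] := I_lt d; lia.
  have [->//|ne] := eqVneq d r; by have [] := I_lt d; lia.
exists r, r', I, K; split.
- split=> //; first by rewrite /r'; case: ifP; [right | left].
    split=> d dr.
      have /andP[I_gt0 AI] := I_ok d dr.
      have := C2 _ _ I_gt0 (KP d _) AI; move: dr; rewrite /r'; case: ifP => _; lia.
    have dr2 : (0 < d < r)%N by move: dr; rewrite /r'; case: ifP; lia.
    have /andP[I_gt0 AI] : (0 < I d.+1)%N && (A (I d.+1) (K d.+1) != 0).
      by apply: I_ok; move: dr; case/andP.
    by rewrite ltnS; apply: (I_lt d dr2).2.
  split=> d dr; last exact: K_lt.
  have := in_nm_neq0 nA (KP d dr); have := ltn_ord (K d); rewrite /allowed /=; lia.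
- move=> b; split=> [|[d dr ->]]; last exact: KP.
  rewrite -mem_ks => bks; exists (index b ks).+1; first by rewrite /= index_mem.
  by rewrite /K /= nth_index.
- move=> a d a_gt0 dr; apply/idP/andP=> [Aa|[dr' /eqP->]]; last first.
    have /I_ok/andP[//] : (0 < d <= r')%N by rewrite dr'; case/andP: dr => ->.
  rewrite (IP a) //; split=> //; rewrite /r'; case: ifP => [_|Ir]; first by lia.
  suff : d != r by lia.
  by apply: contraFneq Ir => <-; apply: I_ex Aa.
Qed.

Lemma comb_shape_rook A : comb_shape A -> rook A.
Proof. by case. Qed.

Lemma entry_graph_row A a b b' :
  entry_graph A (a, b) (a, b') = [&& A a b != 0, A a b' != 0 & b != b'].
Proof. by rewrite entry_graphE xpair_eqE eqxx andbT. Qed.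

Lemma entry_graph_col A a b a' :
  entry_graph A (a, b) (a', b) = [&& A a b != 0, A a' b != 0 & a != a'].
Proof. by rewrite entry_graphE xpair_eqE eqxx orbT !andbT. Qed.

Lemma edge_wlog A (C : 'I_n.+1 * 'I_n.+1 -> Prop) :
    (forall a b b', b != b' -> A a b != 0 -> A a b' != 0 -> C (a, b)) ->
    (forall a a' b, a != a' -> A a b != 0 -> A a' b != 0 -> C (a, b)) ->
  forall p q, entry_graph A p q -> C p.
Proof.
move=> Crow Ccol [a b] [a' b']; rewrite entry_graphE => /and4P[Aab Aab' + /orP[/eqP e|/eqP e]].
  rewrite -e in Aab' *; rewrite xpair_eqE eqxx => nb; exact: Crow nb Aab Aab'.
rewrite -e in Aab' *; rewrite xpair_eqE eqxx andbT => na; exact: Ccol na Aab Aab'.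
Qed.

Lemma ord_gt0 a : (0 < a)%N = (a != ord0).
Proof. by rewrite lt0n. Qed.

Lemma ord0_neq a : (0 < a)%N -> ord0 != a.
Proof. by rewrite eq_sym ord_gt0. Qed.

Lemma rook_row0_edge A : rook A -> (forall b, A ord0 b = 0) ->
  forall p q, entry_graph A p q -> False.
Proof.
move=> [R1 R2] A0; apply: (@edge_wlog A (fun _ => False)) => [a b b' nb Aa Aa'|a a' b na Aa Aa'].
  have a_gt0 : (0 < a)%N by rewrite ord_gt0; apply: contraNneq Aa => ->; rewrite A0.
  by rewrite (R2 a b b') ?eqxx in nb.
have a_gt0 : (0 < a)%N by rewrite ord_gt0; apply: contraNneq Aa => ->; rewrite A0.
have a'_gt0 : (0 < a')%N by rewrite ord_gt0; apply: contraNneq Aa' => ->; rewrite A0.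
by rewrite (R1 a a' b) ?eqxx in na.
Qed.

Lemma no_edge_components A : (forall p q, entry_graph A p q -> False) ->
  forall S, S \in nontrivial_components A -> False.
Proof.
move=> noE S SA; have SE := @nontrivial_componentsP A (fun _ => False) (ord0, ord0) _ noE S SA.
have : S = set0 by apply/setP=> p; rewrite inE; apply/negP => /SE; apply.
by move=> S0; move: SA; rewrite inE S0 cards0 andbF.
Qed.

Lemma connect_edge0 A p q r : connect (entry_graph A) p q -> entry_graph A q r ->
  connect (entry_graph A) p r.
Proof. by move=> pq /connect1; apply: connect_trans. Qed.

Lemma comb_data_components r r' I K A : rook A -> comb_data r r' I K A ->
  forall S, S \in nontrivial_components A -> forall p, p \in S <-> in_comb r r' I K p.1 p.2.
Proof.
move=> [R1 R2] [adm row0 col]; have rr' := admissible_rank adm.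
have A0K d : (0 < d <= r)%N -> A ord0 (K d) != 0 by move=> dr; apply/row0; exists d.
have con d : (0 < d <= r)%N -> connect (entry_graph A) (ord0, K 1) (ord0, K d).
  move=> dr; have [->//|nK] := eqVneq (K 1) (K d).
  by apply: connect1; rewrite entry_graph_row !A0K //; lia.
apply: (@nontrivial_componentsP A (fun p => in_comb r r' I K p.1 p.2) (ord0, K 1)).
  move=> [a b] /= [[d dr [-> ->]]|[d dr [-> ->]]]; first exact: con.
  have [dr2 /andP[I_gt0 _]] : (0 < d <= r)%N /\ (0 < I d < m)%N.
    by rewrite (admissible_rowP adm) //; lia.
  apply: connect_edge0 (con d dr2) _.
  by rewrite entry_graph_col A0K // col // eqxx ord0_neq // !andbT; case/andP: dr => _ ->.
apply: edge_wlog => [a b b' nb Aa Aa'|a a' b na Aa Aa'] /=.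
  have [a0|a_gt0] := posnP a; last by rewrite (R2 a b b') ?eqxx in nb.
  have {}a0 : a = ord0 by apply: val_inj.
  by left; rewrite a0 in Aa *; have [d dr ->] := (row0 b).1 Aa; exists d.
have [a0|a_gt0] := posnP a.
  have {}a0 : a = ord0 by apply: val_inj.
  by left; rewrite a0 in Aa *; have [d dr ->] := (row0 b).1 Aa; exists d.
have a'0 : a' = ord0.
  by apply/eqP; apply: contraNT na; rewrite -ord_gt0 => a'_gt0; apply/eqP/(R1 _ _ b).
rewrite a'0 in Aa'; have [d dr eb] := (row0 b).1 Aa'.
move: Aa; rewrite eb col // => /andP[dr' /eqP ->].
by right; exists d => //; lia.
Qed.

Lemma comb_representativeP u :
  comb_representative m u <-> u \in Um F n.+1 m /\ comb_shape (u - 1%:M).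
Proof.
split=> [[uU _ comp]|[uU cu]]; split=> //.
- set A := u - 1%:M in comp *.
  have edge a b a' b' : entry_graph A (a, b) (a', b') -> exists r r' (I K : nat -> 'I_n.+1),
    [/\ admissible n.+1 m r r' (fun d => (I d).+1) (fun d => (K d).+1),
        in_comb r r' I K a b, in_comb r r' I K a' b',
        forall a b, in_comb r r' I K a b -> A a b != 0 &
        forall a b a' b', in_comb r r' I K a b -> entry_graph A (a, b) (a', b') ->
          in_comb r r' I K a' b'].
    move=> /nontrivial_component_edge[S [/comp/is_combP[r [r' [I [K [adm SE]]]]] pS qS nz cl]].
    exists r, r', I, K; split=> //; try by apply/SE.
      by move=> c d /SE/nz.
    by move=> c d c' d' /SE/cl H /H/SE.
  split.
  + move=> a a' b a_gt0 a'_gt0 Aa Aa'; apply/eqP; apply/negPn/negP=> na.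
    have /edge[r [r' [I [K [adm Ca Ca' _ _]]]]] : entry_graph A (a, b) (a', b).
      by rewrite entry_graph_col Aa Aa'.
    have rr' := admissible_rank adm.
    case: Ca => [[d _ [a0 _]]|[d dr [ea eb]]]; first by rewrite a0 in a_gt0.
    case: Ca' => [[e _ [a0 _]]|[e er [ea' eb']]]; first by rewrite a0 in a'_gt0.
    case/eqP: na; rewrite ea ea'; congr I; apply: (admissible_col_inj adm); try lia.
    by rewrite -eb.
  + move=> a b b' a_gt0 Aa Aa'; apply/eqP; apply/negPn/negP=> nb.
    have /edge[r [r' [I [K [adm Ca Ca' _ _]]]]] : entry_graph A (a, b) (a, b').
      by rewrite entry_graph_row Aa Aa'.
    case: Ca => [[d _ [a0 _]]|[d dr [ea eb]]]; first by rewrite a0 in a_gt0.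
    case: Ca' => [[e _ [a0 _]]|[e er [ea' eb']]]; first by rewrite a0 in a_gt0.
    case/eqP: nb; rewrite eb eb'; congr K; apply: (admissible_row_inj adm); try lia.
    by rewrite -ea.
  + move=> a b a_gt0 A0 Aa.
    have /edge[r [r' [I [K [adm _ Ca _ _]]]]] : entry_graph A (ord0, b) (a, b).
      by rewrite entry_graph_col A0 Aa ord0_neq.
    case: Ca => [[d _ [a0 _]]|[d dr [-> _]]]; first by rewrite a0 in a_gt0.
    by case/andP: (admissible_rowP adm dr).
  + move=> b b' lt_bb' A0 A0'.
    have /edge[r [r' [I [K [adm Ca Ca' nz cl]]]]] : entry_graph A (ord0, b) (ord0, b').
      rewrite entry_graph_row A0 A0' /=.
      by apply: contraTneq lt_bb' => ->; rewrite ltnn.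
    have rr' := admissible_rank adm.
    have rowC c : in_comb r r' I K ord0 c -> exists2 d, (0 < d <= r)%N & c = K d.
      case=> [[d dr [_ ->]]|[d dr [I0 _]]]; first by exists d.
      by have := admissible_rowP adm dr; rewrite -I0.
    have [d dr eb] := rowC _ Ca; have [e er eb'] := rowC _ Ca'.
    have lt_de : (d < e)%N.
      rewrite ltnNge leq_eqVlt; apply/negP => /orP[/eqP ed|lt_ed].
        by move: lt_bb'; rewrite eb eb' ed ltnn.
      by have := @admissible_col_lt _ _ _ _ adm e d; rewrite -eb -eb'; lia.
    have dr' : (0 < d <= r')%N by lia.
    exists (I d).
      have /andP[-> _] := admissible_rowP adm dr'; rewrite /=.
      by apply: nz; right; exists d.
    move=> a' a'_gt0 Aa'.
    have : in_comb r r' I K a' b'.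
      apply: (cl _ _ _ _ Ca').
      by rewrite entry_graph_col A0' Aa' ord0_neq.
    case=> [[f _ [a0 _]]|[f fr [-> eb'']]]; first by rewrite a0 in a'_gt0.
    have fe : f = e by apply: (admissible_col_inj adm); [lia | lia | rewrite -eb' -eb''].
    by rewrite fe in fr *; apply: (admissible_row_lt adm); lia.
- have nA := elimT (in_UmP u) uU; set A := u - 1%:M in cu nA *.
  have [/existsP[b0 Ab0]|/existsPn A0] := boolP [exists b, A ord0 b != 0].
    have [r [r' [I [K dat]]]] := comb_shape_data nA cu Ab0.
    exact: card_nontrivial_components (comb_data_components (comb_shape_rook cu) dat).
  apply: (@card_nontrivial_components _ (fun _ => False)) => S /no_edge_components[].
  by apply: rook_row0_edge; [apply: comb_shape_rook | move=> b; apply/eqP/negPn/A0].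
- have nA := elimT (in_UmP u) uU; set A := u - 1%:M in cu nA *.
  have [/existsP[b0 Ab0]|/existsPn A0] := boolP [exists b, A ord0 b != 0].
    have [r [r' [I [K dat]]]] := comb_shape_data nA cu Ab0.
    move=> S SA; apply/is_combP; exists r, r', I, K; split; first by case: dat.
    by move=> a b; apply: (comb_data_components (comb_shape_rook cu) dat SA (a, b)).
  move=> S /no_edge_components[].
  by apply: rook_row0_edge; [apply: comb_shape_rook | move=> b; apply/eqP/negPn/A0].
Qed.

Definition consecutive A j k :=
  [&& A ord0 j != 0, A ord0 k != 0, (j < k)%N &
      [forall l : 'I_n.+1, (j < l < k)%N ==> (A ord0 l == 0)]].

Definition comb_to_path A := A *m
  \matrix_(j, k) ((j == k)%:R - (consecutive A j k)%:R * (A ord0 k / A ord0 j)).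

Lemma comb_to_path_sim A : in_nm A -> sim A (comb_to_path A).
Proof.
move=> nA; exists 1%:M; first exact: Um1.
eexists; last by rewrite mul1mx.
apply/in_UmP=> a b ab; rewrite !mxE addrAC subrr add0r.
case: (boolP (consecutive A a b)) => [/and4P[A0a _ lt_ab _]|_]; last by rewrite mul0r oppr0.
by have := in_nm_neq0 nA A0a; move: ab; rewrite /allowed /=; lia.
Qed.

Lemma comb_to_path_consecutive A a j b : consecutive A j b ->
  comb_to_path A a b = A a b - A a j * (A ord0 b / A ord0 j).
Proof.
move=> jb; have [A0j _ lt_jb /forallP jb0] := and4P jb.
have nbj : b != j by apply: contraTneq lt_jb => ->; rewrite ltnn.
rewrite mxE (bigD1 b) //= (bigD1 j) 1?eq_sym //= big1 => [|c /andP[cb cj]].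
  rewrite !mxE eqxx jb [j == b]eq_sym (negPf nbj).
  by rewrite /consecutive ltnn !andbF mul0r subr0 sub0r mulr1 mul1r addr0 mulrN.
rewrite mxE (negPf cb) sub0r; case: (boolP (consecutive A c b)); last by rewrite mul0r oppr0 mulr0.
case/and4P=> A0c _ lt_cb /forallP cb0.
have := jb0 c; have := cb0 j; rewrite lt_cb lt_jb !andbT (negPf A0c) (negPf A0j) !implybF.
by move: cj; rewrite -val_eqE /=; lia.
Qed.

Lemma comb_to_path_nonconsecutive A a b : (forall j, ~~ consecutive A j b) ->
  comb_to_path A a b = A a b.
Proof.
move=> nb; rewrite mxE (bigD1 b) //= big1 => [|c cb]; rewrite mxE (negPf (nb _)) mul0r subr0.
  by rewrite eqxx mulr1 addr0.
by rewrite (negPf cb) mulr0.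
Qed.

Lemma comb_to_path_id A : (forall b b', A ord0 b != 0 -> A ord0 b' != 0 -> b = b') ->
  comb_to_path A = A.
Proof.
move=> A0; apply/matrixP=> a b; rewrite comb_to_path_nonconsecutive // => j.
apply/negP => /and4P[Aj Ab lt_jb _]; by rewrite (A0 j b) ?ltnn in lt_jb.
Qed.

Section PathData.

Variables (r r' : nat) (I K : nat -> 'I_n.+1) (A : 'M[F]_n.+1).
Hypothesis dat : comb_data r r' I K A.

Lemma consecutiveP j k :
  consecutive A j k <-> exists2 d, (0 < d < r)%N & j = K d /\ k = K d.+1.
Proof.
have [adm row0 _] := dat.
have K_lt d e : (0 < d <= r)%N -> (0 < e <= r)%N -> (K d < K e)%N -> (d < e)%N.
  move=> dr er lt_K; rewrite ltnNge leq_eqVlt; apply/negP => /orP[/eqP ed|lt_ed].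
    by move: lt_K; rewrite ed ltnn.
  by have := @admissible_col_lt _ _ _ _ adm e d; lia.
have A0K d : (0 < d <= r)%N -> A ord0 (K d) != 0 by move=> dr; apply/row0; exists d.
split=> [/and4P[/row0[d dr ->] /row0[e er ->] lt_de /forallP no]|[d dr [-> ->]]].
  have {}lt_de := K_lt _ _ dr er lt_de.
  have [ed|ne] := eqVneq d.+1 e; first by exists d; [lia | rewrite -ed].
  have dr1 : (0 < d.+1 <= r)%N by lia.
  have := no (K d.+1); rewrite (negPf (A0K _ dr1)) implybF.
  rewrite (admissible_col_lt adm) ?(admissible_col_lt adm) //; lia.
apply/and4P; split; [apply: A0K; lia | apply: A0K; lia | apply: (admissible_col_lt adm); lia |].
apply/forallP=> l; apply/implyP=> /andP[lt1 lt2]; apply/negPn/negP => /row0[e er el].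
rewrite el in lt1 lt2; have := K_lt _ _ _ er lt1; have := K_lt _ _ er _ lt2; lia.
Qed.

Lemma comb_to_path_link a d : (0 < d < r)%N ->
  comb_to_path A a (K d.+1) =
    A a (K d.+1) - A a (K d) * (A ord0 (K d.+1) / A ord0 (K d)).
Proof.
by move=> dr; apply: comb_to_path_consecutive; apply/consecutiveP; exists d.
Qed.

Lemma comb_to_path_other a b : (forall d, (0 < d < r)%N -> b != K d.+1) ->
  comb_to_path A a b = A a b.
Proof.
move=> nb; apply: comb_to_path_nonconsecutive => j; apply/negP=> /consecutiveP[d dr [_ e]].
by have := nb d dr; rewrite e eqxx.
Qed.

Lemma col_dec b : (exists2 d, (0 < d < r)%N & b = K d.+1) \/
  (forall d, (0 < d < r)%N -> b != K d.+1).
Proof.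
have [/existsP[d /andP[d_gt0 /eqP e]]|/existsPn no] :=
  boolP [exists d : 'I_r, (0 < d)%N && (b == K d.+1)].
  by left; exists d; rewrite // d_gt0 /=.
by right=> d /andP[d_gt0 lt_dr]; have := no (Ordinal lt_dr); rewrite /= d_gt0.
Qed.

Lemma comb_to_path_row0 b : (comb_to_path A ord0 b != 0) = (b == K 1).
Proof.
have [adm row0 _] := dat; have rr' := admissible_rank adm.
have [[d dr ->]|nb] := col_dec b.
  have A0 : A ord0 (K d) != 0 by apply/row0; exists d => //; lia.
  rewrite comb_to_path_link // mulrCA divff // mulr1 subrr eqxx.
  by apply/esym/negP => /eqP/(admissible_col_inj adm); lia.
rewrite comb_to_path_other //; apply/idP/eqP => [/row0[d dr e]|->]; last first.
  by apply/row0; exists 1%N => //; lia.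
case: d dr e => [|[|d]] // dr e; have := nb d.+1; rewrite e eqxx; lia.
Qed.

Hypothesis rA : rook A.

Lemma comb_to_path_low a b : (0 < a)%N -> comb_to_path A a b != 0 <->
  A a b != 0 \/ exists2 d, (0 < d < r)%N & a = I d /\ b = K d.+1.
Proof.
move=> a_gt0; have [R1 R2] := rA.
have [adm row0 col] := dat; have rr' := admissible_rank adm.
have [[d dr ->]|nb] := col_dec b; last first.
  rewrite comb_to_path_other //; split=> [|[//|[d dr [_ e]]]]; first by left.
  by have := nb d dr; rewrite e eqxx.
have dr1 : (0 < d <= r)%N by lia.
have dr2 : (0 < d.+1 <= r)%N by lia.
have A0 : A ord0 (K d) != 0 by apply/row0; exists d.
have A0' : A ord0 (K d.+1) != 0 by apply/row0; exists d.+1.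
rewrite comb_to_path_link //; have [Aa|Aa] := eqVneq (A a (K d)) 0.
  rewrite Aa mul0r subr0; split=> [|[//|[e er [ea eK]]]]; first by left.
  have ed : d.+1 = e.+1 by apply: (admissible_col_inj adm); [lia | lia | ].
  have := col a d a_gt0 dr1; rewrite Aa eqxx ea; case: ed => ->.
  rewrite eqxx; lia.
have ea : a = I d by move: Aa; rewrite col // => /andP[_ /eqP].
have -> : A a (K d.+1) = 0.
  apply/eqP/negPn/negP=> Aa'.
  by have := admissible_col_inj adm dr1 dr2 (R2 _ _ _ a_gt0 Aa Aa'); lia.
rewrite sub0r oppr_eq0 !mulf_neq0 ?invr_eq0 //; split=> // _.
by right; exists d.
Qed.

Lemma comb_to_path_components :
  forall S, S \in nontrivial_components (comb_to_path A) ->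
  forall p, p \in S <-> in_path r r' I K p.1 p.2.
Proof.
have [R1 R2] := rA; have [adm row0 col] := dat; have rr' := admissible_rank adm.
set Z := comb_to_path A.
have I_gt0 d : (0 < d <= r')%N -> (0 < I d)%N by case/(admissible_rowP adm)/andP.
have Z0 : Z ord0 (K 1) != 0 by rewrite comb_to_path_row0.
have Zd d : (0 < d <= r')%N -> Z (I d) (K d) != 0.
  move=> dr; apply/(comb_to_path_low _ (I_gt0 d dr)); left; rewrite col ?I_gt0 // ?eqxx; lia.
have ZS d : (0 < d < r)%N -> Z (I d) (K d.+1) != 0.
  by move=> dr; apply/comb_to_path_low; [apply: I_gt0; lia | right; exists d].
have con d : (0 < d <= r')%N -> connect (entry_graph Z) (ord0, K 1) (I d, K d).
  elim: d => // -[|d] IHd dr.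
    by apply: connect1; rewrite entry_graph_col Z0 Zd // ord0_neq // I_gt0.
  apply: (@connect_edge0 _ _ (I d.+1, K d.+2)); last first.
    rewrite entry_graph_col ZS ?Zd //; last lia.
    have lt_I : (I d.+2 < I d.+1)%N by apply: (admissible_row_lt adm); lia.
    by apply: contraTneq lt_I => ->; rewrite ltnn.
  apply: connect_edge0 (IHd _) _; first lia.
  rewrite entry_graph_row ZS ?Zd //; try lia.
  have lt_K : (K d.+1 < K d.+2)%N by apply: (admissible_col_lt adm); lia.
  by apply: contraTneq lt_K => ->; rewrite ltnn.
apply: (@nontrivial_componentsP Z (fun p => in_path r r' I K p.1 p.2) (ord0, K 1)).
  move=> [a b] /= [[-> ->]|[d dr [-> ->]]|[d dr [-> ->]]] //; first exact: con.
  apply: connect_edge0 (con d _) _; first lia.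
  rewrite entry_graph_row ZS ?Zd //; try lia.
  have lt_K : (K d < K d.+1)%N by apply: (admissible_col_lt adm); lia.
  by apply: contraTneq lt_K => ->; rewrite ltnn.
have row0C a b : Z a b != 0 -> (a : nat) = 0%N -> a = ord0 /\ b = K 1.
  move=> Zab a0; have ea : a = ord0 by apply: val_inj.
  by split=> //; move: Zab; rewrite ea comb_to_path_row0 => /eqP.
have uniqI d a : (0 < a)%N -> (0 < d <= r)%N -> A a (K d) != 0 ->
    (0 < d <= r')%N /\ a = I d.
  by move=> a_gt0 dr; rewrite col // => /andP[dr' /eqP ->]; rewrite dr'; case/andP: dr => ->.
apply: edge_wlog => [a b b' nb Za Za'|a a' b na Za Za'] /=.
  have [/(row0C _ _ Za)|a_gt0] := posnP a; first by constructor 1.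
  case/(comb_to_path_low _ a_gt0): (Za) => [Aa|[d dr [ea eb]]]; last first.
    by constructor 3; exists d.
  case/(comb_to_path_low _ a_gt0): (Za') => [Aa'|[d dr [ea eb]]].
    by rewrite (R2 _ _ _ a_gt0 Aa Aa') eqxx in nb.
  constructor 2; exists d; first by lia.
  split=> //; apply: (R2 a) => //.
  rewrite col // ?ea ?eqxx; lia.
have [/(row0C _ _ Za)|a_gt0] := posnP a; first by constructor 1.
case/(comb_to_path_low _ a_gt0): (Za) => [Aa|[d dr [ea eb]]]; last first.
  by constructor 3; exists d.
have [d [dr eb]] : exists d, (0 < d <= r)%N /\ b = K d.
  have [/(row0C _ _ Za')[_ ->]|a'_gt0] := posnP a'; first by exists 1%N; split=> //; lia.
  case/(comb_to_path_low _ a'_gt0): (Za') => [Aa'|[d dr [_ ->]]].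
    by rewrite (R1 _ _ _ a_gt0 a'_gt0 Aa Aa') eqxx in na.
  by exists d.+1; split=> //; lia.
rewrite eb in Aa *; have [dr' ->] := uniqI d a a_gt0 dr Aa.
by constructor 2; exists d.
Qed.

End PathData.

Definition path_shape Z := exists A, [/\ in_nm A, comb_shape A & Z = comb_to_path A].

Section PathToComb.

Variables (Z : 'M[F]_n.+1) (r r' : nat) (I K : nat -> 'I_n.+1).
Hypothesis nZ : in_nm Z.
Hypothesis adm : admissible n.+1 m r r' (fun d => (I d).+1) (fun d => (K d).+1).
Hypothesis path_neq0 : forall a b, in_path r r' I K a b -> Z a b != 0.
Hypothesis path_edge : forall p q, entry_graph Z p q -> in_path r r' I K p.1 p.2.

(* [comb_coef e] is the entry of the comb at [(1, k_(e+1))]; it is forced by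
   requiring that [comb_to_path] produce the entry [Z (I e) (K e.+1)]. *)
Fixpoint comb_coef e : F :=
  if e is e'.+1 then - (Z (I e) (K e.+1) / Z (I e) (K e)) * comb_coef e'
  else Z ord0 (K 1).

Definition path_to_comb : 'M[F]_n.+1 := \matrix_(a, b)
  if a == ord0 then
    if [pick e : 'I_r | b == K e.+1] is Some e then comb_coef e else 0
  else if [exists d : 'I_r, [&& (0 < d)%N, a == I d & b == K d.+1]] then 0
  else Z a b.

Let rr' := admissible_rank adm.

Let I_gt0 d : (0 < d <= r')%N -> (0 < I d)%N.
Proof. by case/(admissible_rowP adm)/andP. Qed.

Let K_neq d e : (0 < d <= r)%N -> (0 < e <= r)%N -> d != e -> K d != K e.
Proof. by move=> dr er; apply: contraNneq => /(admissible_col_inj adm)->. Qed.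

Lemma path_row_neq0 d : (0 < d <= r')%N -> Z (I d) (K d) != 0.
Proof. by move=> dr; apply: path_neq0; constructor 2; exists d. Qed.

Lemma path_link_neq0 d : (0 < d < r)%N -> Z (I d) (K d.+1) != 0.
Proof. by move=> dr; apply: path_neq0; constructor 3; exists d. Qed.

Lemma path_row0 b : (Z ord0 b != 0) = (b == K 1).
Proof.
have Z0 : Z ord0 (K 1) != 0 by apply: path_neq0; constructor 1.
apply/idP/eqP => [Zb|-> //]; apply/eqP/negPn/negP => nb.
have := @path_edge (ord0, b) (ord0, K 1); rewrite entry_graph_row Zb Z0 nb => /(_ isT) /=.
case=> [[_ e]|[d dr [e _]]|[d dr [e _]]]; first by rewrite e eqxx in nb.
  by have := I_gt0 dr; rewrite -e.
by have := @I_gt0 d; rewrite -e /=; lia.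
Qed.

Lemma comb_coef_neq0 e : (e < r)%N -> comb_coef e != 0.
Proof.
elim: e => [|e IHe] lt_er /=; first by rewrite path_row0.
rewrite mulf_neq0 ?IHe ?oppr_eq0 1?ltnW // mulf_neq0 ?invr_eq0 //.
  by apply: path_link_neq0.
by apply: path_row_neq0; lia.
Qed.

Lemma path_to_comb_row0 d : (0 < d <= r)%N -> path_to_comb ord0 (K d) = comb_coef d.-1.
Proof.
case: d => // d lt_dr; rewrite mxE eqxx; case: pickP => [e /eqP eK|/(_ (Ordinal lt_dr))]; last first.
  by rewrite eqxx.
have lt_e := ltn_ord e.
by have [->] : d.+1 = e.+1 by apply: (admissible_col_inj adm).
Qed.

Lemma path_to_comb_row0_neq0 b :
  path_to_comb ord0 b != 0 <-> exists2 d, (0 < d <= r)%N & b = K d.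
Proof.
split=> [|[d dr ->]]; last by rewrite path_to_comb_row0 // comb_coef_neq0 //; lia.
rewrite mxE eqxx; case: pickP => [e /eqP-> _|]; last by rewrite eqxx.
by exists e.+1 => //=.
Qed.

Lemma path_to_comb_low a b : (0 < a)%N ->
  path_to_comb a b = 0 /\ (exists2 d, (0 < d < r)%N & a = I d /\ b = K d.+1) \/
  path_to_comb a b = Z a b /\ ~ (exists2 d, (0 < d < r)%N & a = I d /\ b = K d.+1).
Proof.
rewrite ord_gt0 => /negPf a_gt0; rewrite mxE a_gt0.
case: existsP => [[d /and3P[d_gt0 /eqP-> /eqP->]]|no].
  by left; split=> //; exists d; rewrite ?d_gt0 /=.
right; split=> // -[d /andP[d_gt0 lt_dr] [ea eb]]; case: no.
by exists (Ordinal lt_dr); rewrite /= d_gt0 ea eb !eqxx.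
Qed.

Lemma path_to_comb_low_neq0 a b : (0 < a)%N -> path_to_comb a b != 0 ->
  Z a b != 0 /\ ~ (exists2 d, (0 < d < r)%N & a = I d /\ b = K d.+1).
Proof. by move=> /(path_to_comb_low b)[[-> _]|[-> ?]]; rewrite ?eqxx. Qed.

Lemma path_edge_low a b q : (0 < a)%N -> path_to_comb a b != 0 ->
  entry_graph Z (a, b) q -> exists2 d, (0 < d <= r')%N & a = I d /\ b = K d.
Proof.
move=> a_gt0 /path_to_comb_low_neq0[] // _ no /path_edge[[/= a0 _]|//|//].
by rewrite a0 in a_gt0.
Qed.

Lemma path_to_comb_rook : rook path_to_comb.
Proof.
split=> [a a' b a_gt0 a'_gt0 Aa Aa'|a b b' a_gt0 Aa Aa'].
  have [Za _] := path_to_comb_low_neq0 a_gt0 Aa; have [Za' _] := path_to_comb_low_neq0 a'_gt0 Aa'.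
  apply/eqP/negPn/negP => na.
  have [] := @path_edge_low a b (a', b) a_gt0 Aa; first by rewrite entry_graph_col Za Za'.
  have [] := @path_edge_low a' b (a, b) a'_gt0 Aa'.
    by rewrite entry_graph_col Za Za' eq_sym.
  move=> d dr [ea' eb] e er [ea eb']; case/eqP: na; rewrite ea ea'; congr I.
  by apply: (admissible_col_inj adm); [lia | lia | rewrite -eb -eb'].
have [Za _] := path_to_comb_low_neq0 a_gt0 Aa; have [Za' _] := path_to_comb_low_neq0 a_gt0 Aa'.
apply/eqP/negPn/negP => nb.
have [] := @path_edge_low a b (a, b') a_gt0 Aa; first by rewrite entry_graph_row Za Za'.
have [] := @path_edge_low a b' (a, b) a_gt0 Aa'.
  by rewrite entry_graph_row Za Za' eq_sym.
move=> d dr [ea eb] e er [ea' eb']; case/eqP: nb; rewrite eb eb'; congr K.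
by apply: (admissible_row_inj adm); rewrite -?ea -?ea'.
Qed.

Lemma path_to_comb_data : comb_data r r' I K path_to_comb.
Proof.
split=> // [|a d a_gt0 dr]; first exact: path_to_comb_row0_neq0.
apply/idP/andP=> [Aa|[dr' /eqP ea]]; last first.
  have dr1 : (0 < d <= r')%N by rewrite dr'; case/andP: dr => ->.
  have [[_ [e er [eI eK]]]|[-> _]] := path_to_comb_low (K d) a_gt0; last first.
    by rewrite ea path_row_neq0.
  have de : d = e by apply: (admissible_row_inj adm); [lia | lia | rewrite -ea].
  have : K d != K e.+1 by apply: K_neq; lia.
  by rewrite eK eqxx.
have [Za no] := path_to_comb_low_neq0 a_gt0 Aa.
have [q aq] : exists q, entry_graph Z (a, K d) q.
  have [d1|d_gt1] := eqVneq d 1%N.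
    by rewrite d1 in Za *; exists (ord0, K 1); rewrite entry_graph_col Za path_row0 eqxx -ord_gt0.
  have dr1 : (0 < d.-1 < r)%N by lia.
  have := path_link_neq0 dr1; rewrite prednK => [ZI|]; last by lia.
  exists (I d.-1, K d); rewrite entry_graph_col Za ZI /=.
  by apply/negP=> /eqP ea; case: no; exists d.-1; rewrite // prednK; last by lia.
have [e er [ea eK]] := path_edge_low a_gt0 Aa aq.
have -> : d = e by apply: (admissible_col_inj adm) => //; lia.
by rewrite ea; case/andP: er.
Qed.

Lemma path_to_comb_in_nm : in_nm path_to_comb.
Proof.
move=> a b ab; apply/eqP/negPn/negP => Aab.
have [a0|a_gt0] := posnP a.
  have ea : a = ord0 by apply: val_inj.
  rewrite ea in Aab ab; have [d dr eb] := (path_to_comb_row0_neq0 b).1 Aab.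
  by case/negP: ab; rewrite eb /allowed /=; have := admissible_colP adm dr; lia.
by have [Za _] := path_to_comb_low_neq0 a_gt0 Aab; rewrite nZ ?eqxx in Za.
Qed.

Lemma path_to_combK : comb_to_path path_to_comb = Z.
Proof.
apply/matrixP=> a b; have dat := path_to_comb_data.
have [[d dr ->]|nb] := col_dec r K b.
  have dr1 : (0 < d <= r)%N by lia.
  have dr2 : (0 < d.+1 <= r)%N by lia.
  have dr3 : (0 < d <= r')%N by lia.
  rewrite (comb_to_path_link dat) // !path_to_comb_row0 //.
  have c0 : comb_coef d.-1 != 0 by apply: comb_coef_neq0; lia.
  have [a0|a_gt0] := posnP a.
    have -> : a = ord0 by apply: val_inj.
    rewrite !path_to_comb_row0 // mulrCA divff // mulr1 subrr.
    by apply/esym/eqP/negPn; rewrite path_row0; apply: K_neq; lia.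
  have cE : comb_coef d = - (Z (I d) (K d.+1) / Z (I d) (K d)) * comb_coef d.-1.
    by case: d dr {dr1 dr2 dr3 c0}.
  have Zd := path_row_neq0 dr3.
  have [ea|na] := eqVneq a (I d).
    have [[-> _]|[_ []]] := path_to_comb_low (K d.+1) a_gt0; last by exists d.
    have [[_ [e er [eI eK]]]|[-> _]] := path_to_comb_low (K d) a_gt0.
      have de : d = e by apply: (admissible_row_inj adm); [lia | lia | rewrite -ea].
      have : K d != K e.+1 by apply: K_neq; lia.
      by rewrite eK eqxx.
    by rewrite ea cE; field; rewrite c0 Zd.
  have -> : path_to_comb a (K d) = 0.
    by case: dat => _ _ /(_ a d a_gt0 dr1) e; apply/eqP/negPn; rewrite e (negPf na) andbF.
  rewrite mul0r subr0.
  have [[_ [e er [eI eK]]]|[-> _] //] := path_to_comb_low (K d.+1) a_gt0.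
  have de : d.+1 = e.+1 by apply: (admissible_col_inj adm); [lia | lia |].
  by case: de => de; rewrite eI de eqxx in na.
rewrite (comb_to_path_other dat) //.
have [a0|a_gt0] := posnP a; last first.
  have [[_ [d dr [_ e]]]|[-> //]] := path_to_comb_low b a_gt0.
  by have := nb d dr; rewrite e eqxx.
have -> : a = ord0 by apply: val_inj.
have [->|nb1] := eqVneq b (K 1); first by rewrite path_to_comb_row0 //; lia.
have -> : Z ord0 b = 0 by apply/eqP/negPn; rewrite path_row0.
apply/eqP/negPn/negP => /path_to_comb_row0_neq0[[|[|d]] dr e] //.
  by rewrite e eqxx in nb1.
by have := nb d.+1; rewrite e eqxx => /(_ dr).
Qed.

Lemma path_shapeI : path_shape Z.
Proof.
exists path_to_comb; split; first exact: path_to_comb_in_nm.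
  exact: comb_data_shape path_to_comb_data path_to_comb_rook.
by rewrite path_to_combK.
Qed.

End PathToComb.

Lemma no_edge_comb_shape A : (forall p q, ~~ entry_graph A p q) -> comb_shape A.
Proof.
move=> noE.
have col a a' b : A a b != 0 -> A a' b != 0 -> a = a'.
  move=> Aa Aa'; apply/eqP/negPn/negP => na.
  by have := noE (a, b) (a', b); rewrite entry_graph_col Aa Aa' na.
have row a b b' : A a b != 0 -> A a b' != 0 -> b = b'.
  move=> Aa Aa'; apply/eqP/negPn/negP => nb.
  by have := noE (a, b) (a, b'); rewrite entry_graph_row Aa Aa' nb.
split=> [a a' b _ _|a b b' _|a b a_gt0 A0 Aa|b b' lt_bb' A0 A0']; first exact: col.
- exact: row.
- by rewrite (col _ _ _ Aa A0) in a_gt0.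
- by rewrite (row _ _ _ A0 A0') ltnn in lt_bb'.
Qed.

Lemma path_representativeP u :
  path_representative m u <-> u \in Um F n.+1 m /\ path_shape (u - 1%:M).
Proof.
split=> [[uU card1 comp]|[uU [A [nA cA uA]]]]; split=> //.
- have nA := elimT (in_UmP u) uU; set A := u - 1%:M in card1 comp nA *.
  have [/existsP[p /existsP[q pq]]|noE] := boolP [exists p, exists q, entry_graph A p q].
    have [S [SA pS qS S_neq0 S_cl]] := nontrivial_component_edge pq.
    have [r [r' [I [K [adm SE]]]]] := (is_pathP S).1 (comp S SA).
    apply: (path_shapeI nA adm) => [a b /SE/S_neq0//|p' q' pq'].
    have [S' [S'A pS' _ _ _]] := nontrivial_component_edge pq'.
    apply/SE; rewrite -surjective_pairing.
    by rewrite (card_le1_eqP card1 S' S).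
  have noE' p q : ~~ entry_graph A p q.
    by apply: contraNN noE => pq; apply/existsP; exists p; apply/existsP; exists q.
  exists A; split=> //; first exact: no_edge_comb_shape.
  rewrite comb_to_path_id // => b b' Ab Ab'; apply/eqP/negPn/negP => nb.
  by have := noE' (ord0, b) (ord0, b'); rewrite entry_graph_row Ab Ab' nb.
- rewrite uA; have [/existsP[b0 Ab0]|/existsPn A0] := boolP [exists b, A ord0 b != 0].
    have [r [r' [I [K dat]]]] := comb_shape_data nA cA Ab0.
    exact: card_nontrivial_components (comb_to_path_components dat (comb_shape_rook cA)).
  have {}A0 b : A ord0 b = 0 by apply/eqP/negPn/A0.
  rewrite comb_to_path_id => [|b b']; last by rewrite A0 eqxx.
  apply: (@card_nontrivial_components _ (fun _ => False)) => S /no_edge_components[].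
  exact: rook_row0_edge (comb_shape_rook cA) A0.
- rewrite uA; have [/existsP[b0 Ab0]|/existsPn A0] := boolP [exists b, A ord0 b != 0].
    have [r [r' [I [K dat]]]] := comb_shape_data nA cA Ab0.
    move=> S SA; apply/is_pathP; exists r, r', I, K; split; first by case: dat.
    by move=> a b; apply: (comb_to_path_components dat (comb_shape_rook cA) SA (a, b)).
  have {}A0 b : A ord0 b = 0 by apply/eqP/negPn/A0.
  rewrite comb_to_path_id => [|b b']; last by rewrite A0 eqxx.
  move=> S /no_edge_components[].
  exact: rook_row0_edge (comb_shape_rook cA) A0.
Qed.

Lemma comb_representatives : superclass_representatives m (@comb_representative F n.+1 m).
Proof.
apply: superclass_representativesI comb_representativeP _ _.
  exact: comb_shape_exists.
exact: comb_shape_unique.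
Qed.

Lemma path_representatives : superclass_representatives m (@path_representative F n.+1 m).
Proof.
apply: superclass_representativesI path_representativeP _ _ => [A nA|Z Z' _ _ ZZ'].
  have [B AB cB] := comb_shape_exists nA.
  have nB := sim_in_nm AB nA.
  by exists (comb_to_path B); [apply: sim_trans AB (comb_to_path_sim nB) | exists B].
move=> [A [nA cA eZ]] [B [nB cB eZ']]; rewrite eZ eZ' in ZZ' *.
congr comb_to_path; apply: comb_shape_unique => //.
apply: sim_trans (comb_to_path_sim nA) _.
exact: sim_trans ZZ' (sim_sym (comb_to_path_sim nB)).
Qed.

End Superclasses.

Theorem proposition3p1 (F : finFieldType) (n m : nat) (hm : (0 < m)%N) (hmn : (m < n)%N) :
  superclass_representatives m (@comb_representative F n m) /\
  superclass_representatives m (@path_representative F n m).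
Proof.
case: n hmn => // n _.
by split; [apply: comb_representatives | apply: path_representatives].
Qed.
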